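(* Let $A\in\mathbb{R}^{n\times n}$ be invertible and $B\in\mathbb{R}^{n\times n}$ symmetric positive definite. Let $S_i\in\mathbb{R}^{n\times q_i}$, $i=1,\dots,r$, be matrices of full column rank such that $\mathbf{S}=[S_1,\dots,S_r]$ is square and invertible (so $\sum_iq_i=n$), and let $\overline{S}_i\in\mathbb{R}^{n\times q_i}$ be such that $\mathbf{S}^{-\top}=[\overline{S}_1,\dots,\overline{S}_r]$. For a probability vector $p\in\Delta_r$ with all $p_i>0$, let $S=S_i$ with probability $p_i$ and $$\gamma(p)=1-\frac{1}{\mathrm{Tr}\left(B^{1/2}(\mathbf{E}[Z_p])^{-1}B^{1/2}\right)},\qquad \mathbf{E}[Z_p]=\sum_{i=1}^rp_i\,A^\top S_i(S_i^\top AB^{-1}A^\top S_i)^{-1}S_i^\top A .$$ Then $$\min_{p\in\Delta_r,\ p>0}\gamma(p)=1-\frac{1}{\left(\sum_{i=1}^r\left\|B^{-1/2}A^\top S_i\overline{S}_i^\top A^{-\top}B^{1/2}\right\|_F\right)^2}.$$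
   Context: $\Delta_r=\{p\in\mathbb{R}^r:\sum_{i=1}^rp_i=1,\ p\ge0\}$ is the probability simplex. $\|\cdot\|_F$ is the Frobenius norm, $M^{-\top}=(M^{-1})^\top$, $B^{1/2}$ and $B^{-1/2}$ are the symmetric positive definite square roots of $B$ and $B^{-1}$. *)

(* Defs.v *)
From mathcomp Require Import all_boot all_order all_algebra.
From mathcomp Require Import boolp classical_sets reals.

Set Implicit Arguments.
Unset Strict Implicit.
Unset Printing Implicit Defensive.

Import Order.TTheory GRing.Theory Num.Theory.
Local Open Scope classical_set_scope.
Local Open Scope ring_scope.

Definition simplex (R : realType) (r : nat) : set 'rV[R]_r :=
  [set p | \sum_i p 0 i = 1 /\ forall i, 0 <= p 0 i].

Definition positive_simplex (R : realType) (r : nat) : set 'rV[R]_r :=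
  [set p | simplex p /\ forall i, 0 < p 0 i].

Definition frobenius_norm (R : realType) (m n : nat) (M : 'M[R]_(m, n)) : R :=
  Num.sqrt (\sum_i \sum_j M i j ^+ 2).

Definition symposdef (R : realType) (n : nat) (B : 'M[R]_n) : Prop :=
  B^T = B /\ forall u : 'cV[R]_n, u != 0 -> 0 < (u^T *m B *m u) 0 0.

(* When B is symmetric positive definite, the set below is a singleton; the
   value 0 is a default for the matrices that have no such square root. *)
Definition mxsqrt (R : realType) (n : nat) (B : 'M[R]_n) : 'M[R]_n :=
  xget 0 [set C : 'M[R]_n | symposdef C /\ C *m C = B].

(* The n x n matrix [X_1, ..., X_r]; the cast is needed because \mxrow has
   \sum_i q i columns, a number only provably equal to n. *)
Definition hconcat (R : realType) (n r : nat) (q : 'I_r -> nat)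
    (hq : (\sum_i q i)%N = n) (X : forall i, 'M[R]_(n, q i)) : 'M[R]_n :=
  castmx (erefl n, hq) (\mxrow_i X i).

Definition sketchZ (R : realType) (n k : nat) (A B : 'M[R]_n)
    (T : 'M[R]_(n, k)) : 'M[R]_n :=
  A^T *m T *m invmx (T^T *m A *m invmx B *m A^T *m T) *m T^T *m A.

(* Expectation of sketchZ A B T when T = S i with probability p_i. *)
Definition EZ (R : realType) (n r : nat) (q : 'I_r -> nat) (A B : 'M[R]_n)
    (S : forall i, 'M[R]_(n, q i)) (p : 'rV[R]_r) : 'M[R]_n :=
  \sum_i p 0 i *: sketchZ A B (S i).

Definition gamma (R : realType) (n r : nat) (q : 'I_r -> nat) (A B : 'M[R]_n)
    (S : forall i, 'M[R]_(n, q i)) (p : 'rV[R]_r) : R :=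
  1 - 1 / \tr (mxsqrt B *m invmx (EZ A B S p) *m mxsqrt B).

Definition is_min (R : realType) (E : set R) (x : R) : Prop :=
  E x /\ lbound E x.

(* Main.v *)
(* Biorthogonality of the blocks [S_i] and [Sbar_i] inverts the expectation:
     E[Z]^-1 = \sum_i p_i^-1 A^-1 Sbar_i G_i Sbar_i^T A^-T,
   where [G_i = S_i^T A B^-1 A^T S_i] is the Gram matrix of [B^(-1/2) A^T S_i].
   Hence the trace in [gamma p] is [\sum_i c_i^2 / p_i], with [c_i] the norms of
   the theorem, and Cauchy-Schwarz bounds it below by [(\sum_i c_i)^2], with
   equality at [p_i = c_i / \sum_j c_j], which is positive as no [c_i] is 0. *)
Require Import Defs.
From mathcomp Require Import all_boot all_order all_algebra.
From mathcomp Require Import boolp classical_sets reals.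
From mathcomp Require Import complex ring.

Set Implicit Arguments.
Unset Strict Implicit.
Unset Printing Implicit Defensive.

Import Order.TTheory GRing.Theory Num.Theory.
Local Open Scope classical_set_scope.
Local Open Scope ring_scope.

(** * Polynomials evaluated at a symmetric matrix *)

Lemma poly_interpolation (F : fieldType) (f : F -> F) (s : seq F) :
  exists p : {poly F}, {in s, forall x, p.[x] = f x}.
Proof.
elim: s => [|x s [p ps]]; first by exists 0.
have [xs|xNs] := boolP (x \in s).
  by exists p => y; rewrite inE => /predU1P[->|]; exact: ps.
(* Newton's step: [m] vanishes at the earlier nodes but not at [x], so a multiple of it corrects the
   value at [x] alone. *)
pose m := \prod_(y <- s) ('X - y%:P).
have mx0 : m.[x] != 0 by rewrite -rootE root_prod_XsubC.
exists (p + ((f x - p.[x]) / m.[x]) *: m) => y.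
rewrite inE hornerD hornerZ => /predU1P[->|ys].
  by rewrite divfK // subrKC.
have /rootP -> : root m y by rewrite root_prod_XsubC.
by rewrite mulr0 addr0 ps.
Qed.

(* Complexifying gives a unitary diagonalization with real eigenvalues, which is
   enough to evaluate real polynomials at [B]. *)
Lemma symmetric_horner_eq0 (R : rcfType) n (B : 'M[R]_n.+1) : B^T = B ->
  exists s : seq R, {in s, forall d, eigenvalue B d} /\
    forall q : {poly R}, {in s, forall d, root q d} -> horner_mx B q = 0.
Proof.
move=> symB.
pose toC : {rmorphism R -> R[i]} := real_complex R.
pose Bc := map_mx toC B.
have realBc : Bc \is a mxOver Num.real.
  by apply/mxOverP => i j; rewrite mxE complex_real.
have hermBc : Bc \is hermsymmx.
  apply: realsym_hermsym => //; apply/is_hermitianmxP.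
  by rewrite expr0 scale1r /= map_mx_id // /Bc map_trmx symB.
have /orthomx_spectralP Bc_eq := hermitian_normalmx hermBc.
have /mxOverP d_real := hermitian_spectral_diag_real hermBc.
set U := spectralmx Bc in Bc_eq; set d := spectral_diag Bc in Bc_eq d_real.
have unitU : U \in unitmx by exact: spectral_unit.
have dE i : d 0 i = toC (complex.Re (d 0 i)) by rewrite /toC /= RRe_real.
exists [seq complex.Re (d 0 i) | i : 'I_n.+1]; split.
  move=> _ /mapP[i _ ->].
  rewrite eigenvalue_root_char -(fmorph_root toC) map_char_poly.
  rewrite -eigenvalue_root_char -dE.
  (* Eigenvectors are row vectors here, and [Bc = U^-1 D U] gives [U Bc = D U]. *)
  apply/eigenvalueP; exists (row i U).
    rewrite [map_mx _ _]Bc_eq !mulmxA -!row_mul mulmxV // mul1mx.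
    by rewrite row_mul row_diag_mx -scalemxAl -rowE.
  apply/eqP => /(congr1 (mulmx^~ (invmx U))).
  rewrite -row_mul mulmxV // mul0mx => /rowP/(_ i)/eqP.
  by rewrite !mxE eqxx oner_eq0.
move=> q qs; apply: (@map_mx_inj _ _ toC); rewrite map_horner_mx map_mx0.
rewrite [map_mx _ _]Bc_eq horner_mx_uconjC // horner_mx_diag.
suff -> : map_mx (horner (map_poly toC q)) d = 0.
  by rewrite linear0 mulmx0 mul0mx.
apply/rowP => i; rewrite !mxE dE horner_map.
by have /rootP -> := qs _ (map_f _ (mem_enum _ i)); rewrite rmorph0.
Qed.

Lemma horner_mx_sym (R : comNzRingType) n (B : 'M[R]_n.+1) p :
  B^T = B -> (horner_mx B p)^T = horner_mx B p.
Proof.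
move=> symB; elim/poly_ind: p => [|p c IHp]; first by rewrite rmorph0 trmx0.
rewrite rmorphD rmorphM /= horner_mx_X horner_mx_C linearD /= tr_scalar_mx.
by rewrite -mulmxE trmx_mul symB IHp (comm_mx_horner _ (comm_mx_refl B)).
Qed.

(** * Positive definite matrices and their square roots *)

Lemma mulmx_trmx_gt0 (R : realDomainType) n (u : 'cV[R]_n) :
  u != 0 -> 0 < (u^T *m u) 0 0.
Proof.
case/cV0Pn => i ui; rewrite mxE (bigD1 i) //= mxE -expr2.
rewrite ltr_pwDl ?exprn_even_gt0 // sumr_ge0 // => j _.
by rewrite mxE -expr2 sqr_ge0.
Qed.

Lemma symposdef_gram (R : realType) m n (Y : 'M[R]_(m, n)) :
  (forall u : 'cV_n, Y *m u = 0 -> u = 0) -> symposdef (Y^T *m Y).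
Proof.
move=> injY; split=> [|u u0]; first by rewrite trmx_mul trmxK.
rewrite mulmxA -trmx_mul -mulmxA mulmx_trmx_gt0 //.
by apply: contra_neq u0 => /injY.
Qed.

Lemma symposdef_unitmx (R : realType) n (B : 'M[R]_n) :
  symposdef B -> B \in unitmx.
Proof.
case=> _ posB; rewrite -row_free_unit -kermx_eq0.
apply/rowV0Pn => -[v /sub_kermxP vB v0].
have vT0 : v^T != 0 by rewrite -trmx0 (inj_eq trmx_inj).
by have := posB _ vT0; rewrite trmxK vB mul0mx mxE ltxx.
Qed.

(** The form of [invmx B] at [u] is the form of [B] at [invmx B *m u]. *)
Lemma symposdef_invmx (R : realType) n (B : 'M[R]_n) :
  symposdef B -> symposdef (invmx B).
Proof.
move=> pdB; have unitB := symposdef_unitmx pdB; case: pdB => symB posB.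
have symV : (invmx B)^T = invmx B by rewrite trmx_inv symB.
split=> // u u0; have := posB (invmx B *m u).
rewrite trmx_mul symV -!mulmxA (mulKVmx unitB); apply.
by apply: contra_neq u0 => Vu0; rewrite -(mulKVmx unitB u) Vu0 mulmx0.
Qed.

Lemma symposdef_eigenvalue_gt0 (R : realType) n (B : 'M[R]_n) d :
  symposdef B -> eigenvalue B d -> 0 < d.
Proof.
case=> _ posB /eigenvalueP[v vB v0].
have v0' : v^T != 0 by rewrite -trmx0 (inj_eq trmx_inj).
have := posB _ v0'; rewrite trmxK vB -scalemxAl mxE.
have := mulmx_trmx_gt0 v0'; rewrite trmxK => vv_gt0.
by rewrite pmulr_lgt0.
Qed.

(* With [p(d)^4 = d] on the spectrum of [B] and [E = p(B)], the square root
   [E *m E] is a Gram matrix, hence positive definite. *)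
Lemma symposdef_sqrt_exists (R : realType) n (B : 'M[R]_n) :
  symposdef B -> exists C : 'M[R]_n, symposdef C /\ C *m C = B.
Proof.
case: n => [|n] in B *.
  by move=> pdB; exists B; split=> //; apply/matrixP => -[].
move=> pdB; have unitB := symposdef_unitmx pdB.
have [s [s_eig hs]] := symmetric_horner_eq0 pdB.1.
have [p ps] := poly_interpolation (fun x => Num.sqrt (Num.sqrt x)) s.
pose E := horner_mx B p.
have symE : E^T = E.
  exact: (horner_mx_sym _ pdB.1).
have E4 : E *m E *m (E *m E) = B.
  apply/eqP; rewrite -subr_eq0; apply/eqP.
  have <- : horner_mx B (p ^+ 4 - 'X) = 0.
    apply: hs => d /[dup] ds /s_eig /(symposdef_eigenvalue_gt0 pdB) d_gt0.
    rewrite rootE !hornerE ps // (exprM _ 2 2) sqr_sqrtr ?sqrtr_ge0 //.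
    by rewrite sqr_sqrtr ?subrr // ltW.
  by rewrite rmorphB rmorphXn /= horner_mx_X !exprS expr0 mulr1
     -!mulmxE !mulmxA.
exists (E *m E); split=> //.
(* [E] has trivial kernel because its fourth power [B] is invertible. *)
rewrite -{1}symE; apply: symposdef_gram => u Eu0.
by rewrite -(mulKmx unitB u) -{2}E4 -!mulmxA Eu0 !mulmx0.
Qed.

(** The set of square roots is nonempty, so [xget] does not return its default. *)
Lemma mxsqrtP (R : realType) n (B : 'M[R]_n) : symposdef B ->
  symposdef (mxsqrt B) /\ mxsqrt B *m mxsqrt B = B.
Proof. by move=> /symposdef_sqrt_exists /(xgetPex 0). Qed.

(** * Biorthogonal blocks and the inverse of the expectation *)

Lemma hconcat_dual (R : realType) (n r : nat) (q : 'I_r -> nat)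
    (hq : (\sum_i q i)%N = n) (S Sbar : forall i, 'M[R]_(n, q i)) :
  hconcat hq S \in unitmx -> (invmx (hconcat hq S))^T = hconcat hq Sbar ->
  [/\ \sum_i S i *m (Sbar i)^T = 1%:M,
      forall i, (Sbar i)^T *m S i = 1%:M
    & forall i j, i != j -> (Sbar i)^T *m S j = 0].
Proof.
subst n; rewrite /hconcat !castmx_id => unitS /(congr1 trmx).
rewrite trmxK tr_mxrow => invS.
(* The rows of the inverse are the blocks [(Sbar i)^T]. Read blockwise, one product with the inverse
   is the sum of the [S i *m (Sbar i)^T], the other the table of all [(Sbar i)^T *m S j]. *)
have := mulVmx unitS; have := mulmxV unitS; rewrite invS.
rewrite mul_mxrow_mxcol mul_mxcol_mxrow => SSbar.
rewrite -[in X in X -> _](mxdiagZ 1) /mxdiag => /eq_mxblockP SbarS; split=> //.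
- by move=> i; rewrite SbarS eqxx conform_mx_id.
- by move=> i j /negPf ij; rewrite SbarS ij.
Qed.

Lemma invmx_EZ (R : realType) (n r : nat) (q : 'I_r -> nat) (A B : 'M[R]_n)
    (S Sbar : forall i, 'M[R]_(n, q i)) (p : 'rV[R]_r)
    (G := fun i => (S i)^T *m A *m invmx B *m A^T *m S i) :
  A \in unitmx -> (forall i, G i \in unitmx) -> (forall i, p 0 i != 0) ->
  \sum_i S i *m (Sbar i)^T = 1%:M ->
  (forall i, (Sbar i)^T *m S i = 1%:M) ->
  (forall i j, i != j -> (Sbar i)^T *m S j = 0) ->
  invmx (EZ A B S p) =
  \sum_i (p 0 i)^-1 *:
    (invmx A *m Sbar i *m G i *m (Sbar i)^T *m (invmx A)^T).
Proof.
move=> unitA unitG p_neq0 SSbar SbarS1 SbarS0; set W := \sum_i _.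
have SE i j : (S i)^T *m Sbar j = ((Sbar j)^T *m S i)^T.
  by rewrite trmx_mul trmxK.
have ZE i :
    sketchZ A B (S i) = A^T *m S i *m invmx (G i) *m (S i)^T *m A by [].
clearbody G.
(* In the double sum [EZ *m W] biorthogonality kills the cross terms; in the others [p_i] and [G i]
   cancel, leaving [A^T S_i Sbar_i^T A^-T]. *)
suff EW : EZ A B S p *m W = 1%:M.
  by have [unitE _] := mulmx1_unit EW; rewrite -[W](mulKmx unitE) EW mulmx1.
transitivity (\sum_i A^T *m (S i *m (Sbar i)^T) *m (invmx A)^T); last first.
  by rewrite -mulmx_suml -mulmx_sumr SSbar mulmx1 trmx_inv mulmxV ?unitmx_tr.
rewrite /EZ mulmx_suml; apply: eq_bigr => i _.
rewrite mulmx_sumr (bigD1 i) //= big1 ?addr0 => [|j ji].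
  rewrite -scalemxAl -scalemxAr scalerA mulfV // scale1r ZE !mulmxA.
  rewrite (mulmxK unitA) -(mulmxA _ (S i)^T (Sbar i)) SE SbarS1.
  by rewrite trmx1 mulmx1 (mulmxKV (unitG i)).
rewrite -scalemxAl -scalemxAr ZE !mulmxA (mulmxK unitA).
rewrite -(mulmxA _ (S i)^T (Sbar j)) SE SbarS0 //.
by rewrite trmx0 mulmx0 !mul0mx !scaler0.
Qed.

(** * Frobenius norm and the Cauchy-Schwarz bound *)

Lemma sqr_frobenius_norm (R : realType) m n (M : 'M[R]_(m, n)) :
  frobenius_norm M ^+ 2 = \tr (M^T *m M).
Proof.
rewrite sqr_sqrtr; last by do 2 (apply: sumr_ge0 => ? _); exact: sqr_ge0.
rewrite exchange_big; apply: eq_bigr => i _; rewrite mxE.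
by apply: eq_bigr => j _; rewrite mxE expr2.
Qed.

Lemma frobenius_norm_gt0 (R : realType) m n (M : 'M[R]_(m, n)) :
  M != 0 -> 0 < frobenius_norm M.
Proof.
move=> /matrix0Pn[i [j Mij]]; rewrite sqrtr_gt0 (bigD1 i) //= (bigD1 j) //=.
rewrite -addrA ltr_pwDl ?exprn_even_gt0 // addr_ge0 //.
  by apply: sumr_ge0 => ? _; exact: sqr_ge0.
by do 2 (apply: sumr_ge0 => ? _); exact: sqr_ge0.
Qed.

(** The difference of the two sides is the variance, under the weights [p], of [c i / p i], whose
    mean is [\sum_i c i]. *)
Lemma sum_sqr_div_ge (R : realFieldType) (I : finType) (p c : I -> R) :
  \sum_i p i = 1 -> (forall i, 0 < p i) ->
  (\sum_i c i) ^+ 2 <= \sum_i c i ^+ 2 / p i.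
Proof.
move=> p1 p_gt0; set s := \sum_i c i; rewrite -subr_ge0.
have <- : \sum_i p i * (c i / p i - s) ^+ 2 =
    \sum_i c i ^+ 2 / p i - s ^+ 2.
  transitivity (\sum_i (c i ^+ 2 / p i - s * 2 * c i + s ^+ 2 * p i)).
    by apply: eq_bigr => i _; field; rewrite gt_eqF.
  by rewrite big_split sumrB /= -!mulr_sumr p1 -/s; ring.
by apply: sumr_ge0 => i _; rewrite mulr_ge0 ?sqr_ge0 ?ltW.
Qed.

Theorem theorem39 (R : realType) (n r : nat) (q : 'I_r -> nat)
    (n_gt0 : (0 < n)%N) (q_gt0 : forall i, (0 < q i)%N)
    (hq : (\sum_i q i)%N = n)
    (A B : 'M[R]_n) (hA : A \in unitmx) (hB : symposdef B)
    (S Sbar : forall i, 'M[R]_(n, q i))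
    (hrank : forall i, \rank (S i) = q i)
    (hS : hconcat hq S \in unitmx)
    (hSbar : (invmx (hconcat hq S))^T = hconcat hq Sbar) :
  is_min [set gamma A B S p | p in @positive_simplex R r]
    (1 - 1 / (\sum_i frobenius_norm
                (mxsqrt (invmx B) *m A^T *m S i *m (Sbar i)^T
                   *m (invmx A)^T *m mxsqrt B)) ^+ 2).
Proof.
have [SSbar SbarS1 SbarS0] := hconcat_dual hS hSbar.
have [pdP _] := mxsqrtP hB.
have [pdQ QQ] := mxsqrtP (symposdef_invmx hB).
rewrite /gamma; set P := mxsqrt B in pdP *.
set Q := mxsqrt (invmx B) in pdQ QQ *.
have unitP := symposdef_unitmx pdP; have unitQ := symposdef_unitmx pdQ.
have unitAT : A^T \in unitmx by rewrite unitmx_tr.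
pose Y i := Q *m A^T *m S i.
(* [Q] and [A^T] are invertible, and [(Sbar i)^T] is a left inverse of [S i]. *)
have injY i (u : 'cV_(q i)) : Y i *m u = 0 -> u = 0.
  rewrite /Y -!mulmxA => Yu.
  rewrite -[u]mul1mx -(SbarS1 i) -mulmxA -(mulKmx unitAT (S i *m u)).
  by rewrite -(mulKmx unitQ (A^T *m _)) Yu !mulmx0.
have GE i : (S i)^T *m A *m invmx B *m A^T *m S i = (Y i)^T *m Y i.
  by rewrite /Y !trmx_mul trmxK pdQ.1 -QQ !mulmxA.
have unitG i : (S i)^T *m A *m invmx B *m A^T *m S i \in unitmx.
  by rewrite GE; exact/symposdef_unitmx/symposdef_gram/injY.
pose M i := Y i *m (Sbar i)^T *m (invmx A)^T *m P.
pose c i := frobenius_norm (M i).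
rewrite -[X in X ^+ 2]/(\sum_i c i).
(* Since [P] is symmetric and [G_i = Y_i^T Y_i], the i-th summand is [M_i^T M_i / p_i]. *)
have trE (p : 'rV_r) : (forall i, 0 < p 0 i) ->
    \tr (P *m invmx (EZ A B S p) *m P) = \sum_i c i ^+ 2 / p 0 i.
  move=> p_gt0.
  rewrite (invmx_EZ (Sbar := Sbar)) // => [|i]; last by rewrite gt_eqF.
  rewrite mulmx_sumr mulmx_suml linear_sum /=; apply: eq_bigr => i _.
  rewrite -scalemxAr -scalemxAl linearZ /= GE mulrC; congr (_ * _).
  by rewrite sqr_frobenius_norm /M !trmx_mul !trmxK pdP.1 !mulmxA.
(* [Y i] is recovered from [M i] by right multiplications, so [M i = 0] would make the injective
   [Y i] kill the all-ones vector, nonzero as [q i > 0]. *)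
have c_gt0 i : 0 < c i.
  apply: frobenius_norm_gt0; apply/negP => /eqP Mi0.
  have : Y i *m const_mx 1 = 0 :> 'cV_n.
    suff -> : Y i = M i *m invmx P *m A^T *m S i by rewrite Mi0 !mul0mx.
    rewrite /M (mulmxK unitP) trmx_inv (mulmxKV unitAT).
    by rewrite -mulmxA SbarS1 mulmx1.
  move=> /injY /matrixP/(_ (Ordinal (q_gt0 i)) 0)/eqP.
  by rewrite !mxE oner_eq0.
have r_gt0 : (0 < r)%N.
  rewrite lt0n; apply/eqP => r0; move: n_gt0; rewrite -hq.
  by subst r; rewrite big_ord0.
have s_gt0 : 0 < \sum_i c i.
  rewrite (bigD1 (Ordinal r_gt0)) //= ltr_pwDl // sumr_ge0 // => i _.
  exact: ltW.
split.
  exists (\row_i (c i / \sum_j c j)).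
    have p_gt0 i : 0 < (\row_i (c i / \sum_j c j)) 0 i by rewrite mxE divr_gt0.
    split=> //; split=> [|i]; last exact: ltW.
    under eq_bigr do rewrite mxE.
    by rewrite -mulr_suml divff // gt_eqF.
  rewrite trE => [|i]; last by rewrite mxE divr_gt0.
  (* At this point [c i ^+ 2 / p i] equals [c i * \sum_j c j]. *)
  congr (1 - 1 / _); rewrite [RHS]expr2 mulr_suml; apply: eq_bigr => i _.
  by rewrite mxE; field; rewrite !gt_eqF.
move=> _ [p [[p1 _] p_gt0] <-]; rewrite trE //.
have le_s := sum_sqr_div_ge c p1 p_gt0.
(* The map [t -> 1 - 1 / t] is increasing on positive [t]. *)
by rewrite lerD2l lerN2 !div1r lef_pV2 // posrE
  ?(lt_le_trans _ le_s) ?exprn_gt0.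
Qed.
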